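(* Let $\mathcal{H}$ be a separable complex Hilbert space, let $\Lambda=\{\Lambda_i\}_{i\in J}$ and $\Theta=\{\Theta_i\}_{i\in J}$ be sequences with $\Lambda_i,\Theta_i\in\mathcal{L}(\mathcal{H},\mathcal{H}_i)$, let $m=(m_i)_{i\in J}$ be a sequence of scalars, and suppose that $M_{m,\Lambda,\Theta}$ is well defined and invertible on $\mathcal{H}$. Then: (i) If $\Theta$ is a g-Bessel sequence for $\mathcal{H}$ with bound $B_\Theta$, then $m\Lambda$ satisfies the lower g-frame condition for $\mathcal{H}$ with bound $\frac{1}{B_\Theta\|M_{m,\Lambda,\Theta}^{-1}\|^2}$. Respectively, if $\Lambda$ is a g-Bessel sequence for $\mathcal{H}$ with bound $B_\Lambda$, then $m\Theta$ satisfies the lower g-frame condition for $\mathcal{H}$ with bound $\frac{1}{B_\Lambda\|M_{m,\Lambda,\Theta}^{-1}\|^2}$. (ii) If $\Theta$ and $m\Lambda$ are g-Bessel sequences for $\mathcal{H}$, then both are g-frames for $\mathcal{H}$. Respectively, if $\Lambda$ and $m\Theta$ are g-Bessel sequences for $\mathcal{H}$, then both are g-frames for $\mathcal{H}$. (iii) If $\Theta$ is a g-Bessel sequence for $\mathcal{H}$ and $m\in\ell^\infty$, then $\Lambda$ satisfies the lower g-frame condition for $\mathcal{H}$. Respectively, if $\Lambda$ is a g-Bessel sequence for $\mathcal{H}$ and $m\in\ell^\infty$, then $\Theta$ satisfies the lower g-frame condition for $\mathcal{H}$. (iv) If $\Theta$ and $\Lambda$ are g-Bessel sequences for $\mathcal{H}$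 and $m\in\ell^\infty$, then $\Theta$, $\Lambda$, $m\Lambda$ and $m\Theta$ are all g-frames for $\mathcal{H}$.
   Context: $J\subseteq\mathbb{Z}$ is an index set, $\{\mathcal{H}_i\}_{i\in J}$ is a sequence of separable complex Hilbert spaces, and $\mathcal{L}(\mathcal{H},\mathcal{H}_i)$ is the set of bounded linear operators $\mathcal{H}\to\mathcal{H}_i$. $M_{m,\Lambda,\Theta}f=\sum_{i\in J}m_i\Lambda_i^{\star}\Theta_if$; it is well defined on $\mathcal{H}$ if the series converges in norm for every $f\in\mathcal{H}$, and invertible on $\mathcal{H}$ if it is a bounded bijection of $\mathcal{H}$ with bounded inverse. $m\Lambda=\{m_i\Lambda_i\}_{i\in J}$ and $m\Theta=\{m_i\Theta_i\}_{i\in J}$. A family $\{\Lambda_i\}_{i\in J}$, $\Lambda_i\in\mathcal{L}(\mathcal{H},\mathcal{H}_i)$, satisfies the lower g-frame condition with bound $A>0$ if $A\|f\|^2\le\sum_{i\in J}\|\Lambda_if\|^2$ for all $f\in\mathcal{H}$ (the sum may be $+\infty$); it is a g-Bessel sequence with bound $B>0$ if $\sum_{i\in J}\|\Lambda_if\|^2\le B\|f\|^2$ for all $f\in\mathcal{H}$; it is a g-frame if both hold for some $A,B>0$. *)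

(* Defs.v *)
From HB Require Import structures.
From mathcomp Require Import all_boot all_order all_algebra.
From mathcomp Require Import sesquilinear.
From mathcomp Require Import complex.
From mathcomp Require Import all_classical all_reals all_analysis.

Set Implicit Arguments.
Unset Strict Implicit.
Unset Printing Implicit Defensive.

Import Order.TTheory GRing.Theory Num.Theory.
Import numFieldNormedType.Exports.

Local Open Scope classical_set_scope.
Local Open Scope complex_scope.
Local Open Scope ring_scope.

(* The inner product is linear in its first argument. *)
HB.mixin Record NormedModule_isHilbert (R : realType) H
    of CompleteNormedModule R[i] H := {
  inner : {dot H for (@Num.conj R[i])} ;
  innerE : forall f : H, inner f f = `|f| ^+ 2
}.

#[short(type="hilbertType")]
HB.structure Definition Hilbert (R : realType) :=
  { H of CompleteNormedModule R[i] H & NormedModule_isHilbert R H }.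

(* The library norm of a space over R[i] takes values in R[i]. *)
Definition rnorm (R : realType) (H : hilbertType R) (f : H) : R :=
  complex.Re `|f|.

Definition separable (T : topologicalType) : Prop :=
  exists2 D : set T, countable D & dense D.

Section Operators.
Context {R : realType}.

Definition bounded_op {H K : hilbertType R} (T : H -> K) : Prop :=
  exists C : R, forall f, rnorm (T f) <= C * rnorm f.

Definition opnorm {H K : hilbertType R} (T : H -> K) : R :=
  sup [set rnorm (T f) | f in [set f | rnorm f <= 1]].

(* For bounded linear T the set below is a singleton, by the Riesz
   representation theorem. *)
Definition adjoint {H K : hilbertType R} (T : H -> K) : K -> H :=
  get [set S : K -> H | forall f g, inner (T f) g = inner f (S g)].

Definition op_inv {H K : hilbertType R} (T : H -> K) : K -> H :=
  'pinv_(fun=> 0) [set: H] T.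

Definition invertible {H : hilbertType R} (T : H -> H) : Prop :=
  [/\ bounded_op T, bijective T & bounded_op (op_inv T)].

End Operators.

Section GFrames.
Context {R : realType} {H : hilbertType R} {Hi : int -> hilbertType R}.
Implicit Types (J : set int) (m : int -> R[i]).
Implicit Types (Lambda Theta : forall i, H -> Hi i).

Local Open Scope ereal_scope.

Definition gsum J Lambda (f : H) : \bar R :=
  \esum_(i in J) ((rnorm (Lambda i f) ^+ 2)%R)%:E.

(* The bound is an extended real so that 1 / (B * ||M^-1||^2) keeps a meaning,
   namely +oo, on the zero space, where ||M^-1|| = 0. *)
Definition lower_gframe_bound J Lambda (A : \bar R) : Prop :=
  0 < A /\ forall f : H, A * ((rnorm f ^+ 2)%R)%:E <= gsum J Lambda f.

Definition lower_gframe J Lambda : Prop :=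
  exists A : R, lower_gframe_bound J Lambda A%:E.

Definition gbessel_bound J Lambda (B : R) : Prop :=
  (0 < B)%R /\
  forall f : H, gsum J Lambda f <= (B * rnorm f ^+ 2)%R%:E.

Definition gbessel J Lambda : Prop :=
  exists B : R, gbessel_bound J Lambda B.

Definition gframe J Lambda : Prop :=
  lower_gframe J Lambda /\ gbessel J Lambda.

Definition gscale m Lambda : forall i, H -> Hi i :=
  fun i f => (m i *: Lambda i f)%R.

(* A series over J is the limit of its sums over the i in J with |i| <= n.
   For J contained in nat these are the usual partial sums.  For general J,
   convergence of the two one-sided series, or unconditional convergence,
   implies convergence in this sense, with the same sum. *)
Definition multiplier_sum J m Lambda Theta (f : H) (n : nat) : H :=
  (\sum_(i \in J `&` [set i : int | (`|i| <= n)%N])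
     m i *: adjoint (Lambda i) (Theta i f))%R.

Definition multiplier_well_defined J m Lambda Theta : Prop :=
  forall f : H, cvgn (multiplier_sum J m Lambda Theta f).

Definition multiplier J m Lambda Theta (f : H) : H :=
  limn (multiplier_sum J m Lambda Theta f).

Definition ell_infty J m : Prop :=
  exists C : R, forall i, J i -> (`|m i| <= C%:C)%R.

End GFrames.

(* Main.v *)
(* Young's inequality applied to each term <m_i Theta_i f, Lambda_i g> gives
   2 Re <M f, g> <= t sum |Theta_i f|^2 + t^-1 sum |m_i Lambda_i g|^2, t > 0,
   and the same with m moved onto Theta.  If Theta is g-Bessel with bound B, take
   f = M^-1 g: the first sum is at most B |M^-1|^2 |g|^2, and optimising in t
   bounds |g|^2 by B |M^-1|^2 times the second sum.  If the second family is
   g-Bessel, take g = M f instead.  Moving Lambda_i across the inner product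
   needs the existence of adjoints, hence the Riesz representation theorem. *)

Require Import Defs.
From HB Require Import structures.
From mathcomp Require Import all_boot all_order all_algebra.
From mathcomp Require Import sesquilinear complex ring lra.
From mathcomp Require Import all_classical all_reals all_analysis.

Import Order.TTheory GRing.Theory Num.Theory.
Import numFieldNormedType.Exports.

Local Open Scope classical_set_scope.
Local Open Scope complex_scope.
Local Open Scope ring_scope.

(** * The real part of the inner product *)

Section InnerProduct.
Context {R : realType} {H : hilbertType R}.
Implicit Types (f g h : H) (t : R).

(** A real inner product with the same norm: Young's inequality and minimisation then take place in
    the ordered field [R]. *)
Definition rdot f g : R := complex.Re (inner f g).

Lemma innerDl f g h : inner (f + g) h = inner f h + inner g h.
Proof. exact: linearDl. Qed.

Lemma innerZl c f g : inner (c *: f) g = c * inner f g.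
Proof. exact: linearZl_LR. Qed.

Lemma innerC f g : inner f g = Num.conj (inner g f).
Proof. by rewrite (hermC inner) expr0 mul1r. Qed.

Lemma innerZr c f g : inner f (c *: g) = Num.conj c * inner f g.
Proof. exact: linearZr_LR. Qed.

Lemma rdotC f g : rdot f g = rdot g f.
Proof. by rewrite /rdot innerC; case: (inner g f). Qed.

Lemma rdotDl f g h : rdot (f + g) h = rdot f h + rdot g h.
Proof. by rewrite /rdot innerDl; case: (inner f h) => ? ?; case: (inner g h). Qed.

Lemma rdotZl t f g : rdot (t%:C *: f) g = t * rdot f g.
Proof. by rewrite /rdot innerZl; case: (inner f g) => a b /=; ring. Qed.

Lemma rdotDr f g h : rdot h (f + g) = rdot h f + rdot h g.
Proof. by rewrite rdotC rdotDl !(rdotC _ h). Qed.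

Lemma rdotZr t f g : rdot f (t%:C *: g) = t * rdot f g.
Proof. by rewrite rdotC rdotZl rdotC. Qed.

Lemma rdot_suml (I : Type) (s : seq I) (F : I -> H) g :
  rdot (\sum_(i <- s) F i) g = \sum_(i <- s) rdot (F i) g.
Proof.
elim: s => [|i s IHs]; last by rewrite !big_cons rdotDl IHs.
by rewrite !big_nil -[0 in LHS](scale0r (0 : H)) rdotZl mul0r.
Qed.

Lemma rnormE f : (rnorm f)%:C = `|f|.
Proof. by rewrite /rnorm RRe_real// normr_real. Qed.

Lemma rnorm_ge0 f : 0 <= rnorm f.
Proof. by rewrite -ler0c rnormE. Qed.

Lemma rnorm_eq0 f : (rnorm f == 0) = (f == 0).
Proof. by rewrite -(normr_eq0 f) -rnormE; rewrite eq_complex/= eqxx andbT. Qed.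

Lemma rnormZ c f : rnorm (c *: f) = complex.Re `|c| * rnorm f.
Proof.
apply: complexI; rewrite rnormE normrZ -(rnormE f).
by rewrite -[`|c|](RRe_real (normr_real c)) -rmorphM.
Qed.

Lemma rnormZ_real t f : rnorm (t%:C *: f) = `|t| * rnorm f.
Proof. by rewrite rnormZ normc_def/= expr0n/= addr0 sqrtr_sqr. Qed.

Lemma rnorm_sqr f : rnorm f ^+ 2 = rdot f f.
Proof. by rewrite /rdot innerE -rnormE -rmorphXn. Qed.

Lemma rnorm_sqrD f g :
  rnorm (f + g) ^+ 2 = rnorm f ^+ 2 + 2 * rdot f g + rnorm g ^+ 2.
Proof. by rewrite !rnorm_sqr rdotDl !rdotDr (rdotC g f); ring. Qed.

Lemma rdot_young t f g : 0 < t ->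
  2 * rdot f g <= t * rnorm f ^+ 2 + t^-1 * rnorm g ^+ 2.
Proof.
move=> t0; have := sqr_ge0 (rnorm (t%:C *: f + (-1)%:C *: g)).
rewrite rnorm_sqrD rdotZl rdotZr !rnormZ_real normrN1 mul1r (gtr0_norm t0) => h.
rewrite -(ler_pM2l t0) mulrDr (mulrA t t^-1) divff ?gt_eqF// mul1r.
by rewrite exprMn in h; lra.
Qed.

(** Cauchy-Schwarz from Young: t = |g| / |f| makes both terms equal to |f| |g|. *)
Lemma rdot_le f g : rdot f g <= rnorm f * rnorm g.
Proof.
have [->|f0] := eqVneq f 0.
  by rewrite -[in leLHS](scale0r (0 : H)) rdotZl mul0r mulr_ge0 ?rnorm_ge0.
have [->|g0] := eqVneq g 0.
  by rewrite -[in leLHS](scale0r (0 : H)) rdotZr mul0r mulr_ge0 ?rnorm_ge0.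
have nf : 0 < rnorm f by rewrite lt_def rnorm_eq0 f0 rnorm_ge0.
have ng : 0 < rnorm g by rewrite lt_def rnorm_eq0 g0 rnorm_ge0.
have := rdot_young _ f g (divr_gt0 ng nf).
rewrite (_ : rnorm g / rnorm f * _ + _ = 2 * (rnorm f * rnorm g)) ?ler_pM2l//.
by field; rewrite !gt_eqF.
Qed.

Lemma eq_of_rdot f g : (forall h, rdot h f = rdot h g) -> f = g.
Proof.
move=> fg; apply/eqP; rewrite -subr_eq0 -rnorm_eq0 -sqrf_eq0 rnorm_sqr.
have -> : f - g = f + (-1)%:C *: g by rewrite rmorphN1 scaleN1r.
by rewrite rdotDr rdotZr fg mulN1r subrr.
Qed.

(** c = 1 gives the real part and c = i the imaginary part. *)
Lemma inner_rdot f g (z : R[i]) :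
    (forall c, rdot (c *: f) g = complex.Re (c * z)) ->
  inner f g = z.
Proof.
move=> e; move: (e 'i%C) (e 1) => {e}; rewrite /rdot !innerZl !mul1r.
case: (inner f g) z => [a b] [c d] /= + ->; rewrite !mul0r !mul1r !sub0r.
by move=> /oppr_inj ->.
Qed.

Lemma rnorm_cvg (u : nat -> H) f : u @ \oo --> f ->
  forall e : R, 0 < e -> \forall n \near \oo, rnorm (u n - f) <= e.
Proof.
move=> /cvgrPdist_le uf e e0.
have /uf : 0 < e%:C by rewrite ltcR.
apply: filterS => n /=; rewrite distrC -rnormE lecR; exact.
Qed.

End InnerProduct.

(** * Riesz representation of bounded real functionals *)

Lemma inv_succ_lt {R : realType} (e : R) : 0 < e ->
  \forall n \near \oo, n.+1%:R^-1 < e.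
Proof. by move=> e0; exact: (near_infty_natSinv_lt (PosNum e0)). Qed.

(* The representing vector minimises the functional |f|^2 - 2 phi(f): by the
   parallelogram law a minimising sequence is Cauchy. *)
Lemma real_riesz {R : realType} {H : hilbertType R} (phi : H -> R) (C : R) :
    (forall f g, phi (f + g) = phi f + phi g) ->
    (forall t f, phi (t%:C *: f) = t * phi f) ->
    (forall f, phi f <= C * rnorm f) ->
  exists x, forall f, phi f = rdot f x.
Proof.
move=> phiD phiZ phi_le.
pose Q f : R := rnorm f ^+ 2 - 2 * phi f.
have QD f g : Q (f + g) = Q f + rnorm g ^+ 2 + 2 * (rdot f g - phi g).
  by rewrite /Q rnorm_sqrD phiD; ring.
pose d : R := inf (range Q).
have infQ : has_inf (range Q).
  split; first by exists (Q 0); exists 0.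
  (* Complete the square: |f|^2 - 2 C |f| >= - C^2. *)
  exists (- C ^+ 2) => _ [f _ <-]; rewrite /Q.
  by have := sqr_ge0 (rnorm f - C); have := phi_le f; lra.
have leQ f : d <= Q f by apply: ge_inf; [exact: infQ.2|exists f].
have /choice[u Qu] n : exists f, Q f < d + n.+1%:R^-1.
  have n0 : 0 < n.+1%:R^-1 :> R by rewrite invr_gt0.
  by have [_ [f _ <-] fd] := inf_adherent n0 infQ; exists f.
have u_cauchy f g : rnorm (f - g) ^+ 2 <= 2 * (Q f + Q g - 2 * d).
  (* By the parallelogram law, |f - g|^2 = 2 Q f + 2 Q g - 4 Q ((f + g) / 2), the linear terms
     cancelling. *)
  have := leQ ((2^-1 : R)%:C *: (f + g)).
  rewrite /Q rnormZ_real exprMn phiZ phiD rnorm_sqrD.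
  rewrite -[- g]scaleN1r -[-1 : R[i]](rmorphN1 (real_complex R)).
  rewrite rnorm_sqrD rnormZ_real rdotZr normrN1 mul1r ger0_norm ?invr_ge0//.
  by lra.
have /cauchy_cvgP/cvg_ex[x ux] : cauchy (u @ \oo).
  apply/cauchyP => eps eps0.
  have [e e0 ->] : exists2 e : R, 0 < e & eps = e%:C.
    exists (complex.Re eps); last by rewrite RRe_real// gtr0_real.
    by move: eps0; rewrite ltcE => /andP[].
  have e4 : 0 < e ^+ 2 / 4 by rewrite divr_gt0 ?exprn_gt0.
  have [N _ HN] := inv_succ_lt _ e4.
  exists (u N); exists N => // n Nn /=.
  rewrite -ball_normE /= -rnormE ltcR.
  rewrite -(@ltr_pXn2r _ 2) ?nnegrE ?rnorm_ge0 ?ltW//.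
  apply: le_lt_trans (u_cauchy _ _) _.
  have QuN k : (N <= k)%N -> Q (u k) < d + e ^+ 2 / 4.
    by move=> Nk; apply: lt_trans (Qu k) _; rewrite ltrD2l; exact: HN.
  by have := QuN N (leqnn N); have := QuN n Nn; lra.
exists x => f.
(* This says Q (x + t f) >= Q x. It is obtained by letting n grow in d <= Q (u n + t f), half of e
   paying for Q (u n) - d and half for replacing u n by x. *)
have nneg t : 0 <= t ^+ 2 * rnorm f ^+ 2 + 2 * t * (rdot f x - phi f).
  apply/ler_addgt0Pl => e e0.
  pose c := 2 * (`|t| + 1) * (rnorm f + 1).
  have c0 : 0 < c by rewrite !mulr_gt0// ltr_wpDl// rnorm_ge0.
  near \oo => n.
  have : Q (u n) < d + e / 2.
    apply: lt_trans (Qu n) _; rewrite ltrD2l.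
    by near: n; apply: inv_succ_lt; rewrite divr_gt0.
  have h2 : rnorm (u n - x) <= e / 2 / c.
    by near: n; apply: rnorm_cvg => //; rewrite !divr_gt0.
  have := leQ (u n + t%:C *: f); rewrite QD rnormZ_real exprMn phiZ rdotZr.
  rewrite real_normK ?num_real// (rdotC (u n)).
  have -> : rdot f (u n) = rdot f x + rdot f (u n - x).
    by rewrite -rdotDr addrC subrK.
  have : 2 * t * rdot f (u n - x) <= e / 2.
    rewrite -mulrA -rdotZl.
    apply: le_trans (_ : 2 * (rnorm (t%:C *: f) * rnorm (u n - x)) <= _).
      by rewrite ler_pM2l// rdot_le.
    rewrite rnormZ_real.
    apply: le_trans (_ : c * rnorm (u n - x) <= _).
      rewrite !mulrA ler_wpM2r ?rnorm_ge0// /c.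
      have := normr_ge0 t; have := rnorm_ge0 f; nra.
    by rewrite mulrC -ler_pdivlMr.
  lra.
set A := rnorm f ^+ 2 in nneg; set b := rdot f x - phi f in nneg.
suff : b = 0 by rewrite /b; lra.
have A0 : 0 <= A by exact: sqr_ge0.
have A1 : 0 < A + 1 by rewrite ltr_wpDl.
(* Near the minimiser - b / A, but still defined when f = 0; the value is a negative multiple of
   b^2. *)
have := nneg (- b / (A + 1)).
have -> : (- b / (A + 1)) ^+ 2 * A + 2 * (- b / (A + 1)) * b =
    - (b ^+ 2 * ((A + 2) / (A + 1) ^+ 2)) by field; rewrite gt_eqF.
have A2 : 0 < A + 2 by lra.
rewrite oppr_ge0 pmulr_lle0 ?divr_gt0 ?exprn_gt0// => b0.
by apply/eqP; rewrite -sqrf_eq0 eq_le b0 sqr_ge0.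
Unshelve. all: by end_near.
Qed.

(** * Existence and homogeneity of adjoints *)

Section Adjoint.
Context {R : realType} {H K : hilbertType R} (T : {linear H -> K}).

Lemma adjointP : bounded_op T ->
  forall f g, inner (T f) g = inner f (adjoint T g).
Proof.
move=> [C TC].
(* [get] returns an adjoint once some adjoint exists, so Riesz is applied for each g to the real
   functional f -> Re <T f, g>. *)
suff /choice[S TS] g : exists h, forall f, inner (T f) g = inner f h.
  pose adj := [set S : K -> H | forall f g, inner (T f) g = inner f (S g)].
  by apply: (@getPex _ adj); exists S => f g.
have [||f|h hP] := @real_riesz _ H (fun f => rdot (T f) g) (C * rnorm g).
- by move=> f1 f2; rewrite linearD rdotDl.
- by move=> t f; rewrite linearZ rdotZl.
- rewrite mulrAC; apply: le_trans (rdot_le _ _) _.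
  by rewrite ler_wpM2r ?rnorm_ge0.
exists h => f; apply: inner_rdot => c.
by rewrite -innerZl -/(rdot _ _) -hP linearZ.
Qed.

Lemma adjointZ (c : R[i]) (g : K) : bounded_op T ->
  adjoint T (c *: g) = c *: adjoint T g.
Proof.
move=> bT; apply: eq_of_rdot => f.
by rewrite /rdot -adjointP// !innerZr adjointP.
Qed.

End Adjoint.

(** * Norm estimates for the inverse operator *)

Section InvertibleOperator.
Context {R : realType} {H : hilbertType R} (M : H -> H).
Hypotheses (MZ : forall c f, M (c *: f) = c *: M f) (invM : invertible M).

Lemma op_invK f : op_inv M (M f) = f.
Proof.
case: invM => _ /bij_inj injM _; rewrite /op_inv pinvKV ?inE//.
by move=> x y _ _; apply: injM.
Qed.

Lemma op_invKV g : M (op_inv M g) = g.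
Proof. by have [_ [N _ MK] _] := invM; rewrite -(MK g) op_invK. Qed.

Lemma opnorm_ge0 : 0 <= opnorm (op_inv M).
Proof.
have [_ _ [C le_C]] := invM.
have norm0 : rnorm (0 : H) = 0 by apply/eqP; rewrite rnorm_eq0.
apply: le_trans (rnorm_ge0 (op_inv M 0)) _; apply: ub_le_sup; last first.
  by exists 0 => //=; rewrite norm0.
(* On the zero space C may be negative, hence the absolute value. *)
exists `|C| => _ [f /= f1 <-]; apply: le_trans (le_C f) _.
apply: le_trans (ler_wpM2r (rnorm_ge0 f) (ler_norm C)) _.
by rewrite ler_piMr.
Qed.

Lemma rnorm_le_opnorm f : rnorm f <= opnorm (op_inv M) * rnorm (M f).
Proof.
have [_ _ [C le_C]] := invM.
have [Mf0|Mf0] := eqVneq (rnorm (M f)) 0.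
  by have := le_C (M f); rewrite Mf0 !mulr0 op_invK.
have Mf_gt0 : 0 < rnorm (M f) by rewrite lt_def Mf0 rnorm_ge0.
rewrite -ler_pdivrMr//; apply: ub_le_sup.
  exists `|C| => _ [g /= g1 <-]; apply: le_trans (le_C g) _.
  apply: le_trans (ler_wpM2r (rnorm_ge0 g) (ler_norm C)) _.
  by rewrite ler_piMr.
(* The supremum is tested at M f normalised; homogeneity of M identifies its preimage. *)
exists ((rnorm (M f))^-1%:C *: M f) => /=.
  by rewrite rnormZ_real ger0_norm ?invr_ge0 ?rnorm_ge0// mulVf.
rewrite -MZ op_invK rnormZ_real ger0_norm ?invr_ge0 ?rnorm_ge0//.
by rewrite mulrC.
Qed.

End InvertibleOperator.

(** * Finite index balls and sums of squared norms *)

Lemma finite_int_ball (n : nat) : finite_set [set i : int | (`|i| <= n)%N].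
Proof.
apply: (@sub_finite_set _ _
  ([set Posz k | k in `I_n.+1] `|` [set Negz k | k in `I_n.+1])); last first.
  by rewrite finite_setU; split; apply/finite_image/finite_II.
move=> [k|k] /= kn; first by left; exists k.
(* [Negz k] is -(k + 1), so the covering overshoots by one on this side. *)
by right; exists k => //=; apply: leqW.
Qed.

Section GSums.
Context {R : realType} {H : hilbertType R} {Hi : int -> hilbertType R}.
Implicit Types (J F : set int) (X : forall i, H -> Hi i).

Lemma gsum_ge0 J X f : (0 <= gsum J X f)%E.
Proof. by apply: esum_ge0 => i _; rewrite lee_fin sqr_ge0. Qed.

Lemma sum_le_gsum J X F f : finite_set F -> F `<=` J ->
  ((\sum_(i <- finmap.enum_fset (fset_set F)) rnorm (X i f) ^+ 2)%:E <= gsum J X f)%E.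
Proof.
by move=> finF FJ; apply: esum_ge; exists F; rewrite // fsbig_finite// sumEFin.
Qed.

Lemma gsum_gscale_le J (m : int -> R[i]) X (D : R) f :
    (forall i, J i -> `|m i| <= D%:C) ->
  (gsum J (gscale m X) f <= (D ^+ 2)%:E * gsum J X f)%E.
Proof.
move=> mD; apply: ge_ereal_sup => _ [F [finF FJ] <-].
apply: le_trans (lee_wpmul2l _ (sum_le_gsum _ X _ f finF FJ)); last first.
  by rewrite lee_fin sqr_ge0.
rewrite fsbig_finite// sumEFin -EFinM lee_fin mulr_sumr.
rewrite !big_seq; apply: ler_sum => i; rewrite in_fset_set// inE => /FJ Ji.
have mi := mD i Ji; have mE := RRe_real (normr_real (m i)).
rewrite /gscale rnormZ exprMn ler_wpM2r ?sqr_ge0// lerXn2r ?nnegrE//.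
- by rewrite -ler0c mE.
- by rewrite -ler0c; apply: le_trans mi.
- by rewrite -lecR mE.
Qed.

(** An infinite bound is traded for 1; positivity excludes the value -oo. *)
Lemma lower_gframe_of_bound J X A : lower_gframe_bound J X A -> lower_gframe J X.
Proof.
case: A => [a|[_ h]|[]//]; first by exists a.
exists 1; split=> [|f]; first by rewrite lte_fin.
by apply: le_trans (h f); rewrite lee_wpmul2r ?lee_fin ?sqr_ge0 ?leey.
Qed.

End GSums.

(** * Optimising the Young parameter; reciprocals that may be infinite *)

(** For K > 0, t = 1 / K gives 2 N <= N + K s. For K = 0 large t forces N <= 0. *)
Lemma le_of_young {R : realFieldType} (K N s : R) : 0 <= K -> 0 <= s ->
  (forall t, 0 < t -> 2 * N <= t * (K * N) + t^-1 * s) -> N <= K * s.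
Proof.
move=> K0 s0 h; have [K_eq0|Kn0] := eqVneq K 0; last first.
  have Kgt0 : 0 < K by rewrite lt_def Kn0.
  have := h K^-1; rewrite invr_gt0 invrK mulrA mulVf// => /(_ Kgt0); lra.
rewrite K_eq0 mul0r leNgt; apply/negP => N0.
have s1 : 0 < s + 1 by lra.
(* Here 2 N <= s / t, while s / t = N s / (s + 1) < N. *)
have := h ((s + 1) / N) (divr_gt0 s1 N0); rewrite K_eq0 mul0r mulr0 add0r leNgt.
rewrite invf_div mulrAC ltr_pdivrMr//; nra.
Qed.

Lemma inve_fin_gt0 {R : realType} (K : R) : 0 <= K -> (0 < (K%:E)^-1)%E.
Proof.
by move=> K0; rewrite inver; case: eqVneq => // Kn0; rewrite lte_fin invr_gt0 lt_def Kn0.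
Qed.

(* For K = 0 the factor is +oo; the product is then harmless because N = 0 as
   soon as G is finite. *)
Lemma inve_mul_le {R : realType} (K N : R) (G : \bar R) :
    0 <= K -> 0 <= N -> (0 <= G)%E ->
    (forall s, 0 <= s -> (G <= s%:E)%E -> N <= K * s) ->
  ((K%:E)^-1 * N%:E <= G)%E.
Proof.
case: G => [s||//] K0 N0 s0 h; last by rewrite leey.
have {h} := h s s0 (lexx _); have [->|Kn0] := eqVneq K 0.
  by rewrite mul0r => N_le0; rewrite (@le_anti _ _ N 0) ?mule0// N_le0.
by rewrite inver (negPf Kn0) lee_pdivrMl// lt_def Kn0.
Qed.

(** * Lower bounds from an invertible multiplier *)

Section Multiplier.
Context {R : realType} {J : set int} {H : hilbertType R} {Hi : int -> hilbertType R}.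
Variables (Lambda Theta : forall i : int, {linear H -> Hi i}) (m : int -> R[i]).
Hypotheses (bndLambda : forall i, J i -> bounded_op (Lambda i))
  (wdM : multiplier_well_defined J m Lambda Theta).

Let M := multiplier J m Lambda Theta.
Let ball n := J `&` [set i : int | (`|i| <= n)%N].

Let finite_ball n : finite_set (ball n).
Proof. exact/finite_setIr/finite_int_ball. Qed.

Let multiplier_sumE f n : multiplier_sum J m Lambda Theta f n =
  \sum_(i <- finmap.enum_fset (fset_set (ball n)))
    m i *: adjoint (Lambda i) (Theta i f).
Proof. by rewrite /multiplier_sum fsbig_finite//; exact: finite_ball. Qed.

(** Passes to the limit from the partial sums; it lets the estimate for M^-1 rescale vectors. *)
Lemma multiplierZ (c : R[i]) f : M (c *: f) = c *: M f.
Proof.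
apply: cvg_lim; first exact: norm_hausdorff.
rewrite (_ : multiplier_sum _ _ _ _ _ = c \*: multiplier_sum J m Lambda Theta f).
  by apply: cvgZl_tmp; exact: wdM.
apply/funext => n /=; rewrite !multiplier_sumE scaler_sumr.
apply: eq_big_seq => i; rewrite in_fset_set// inE => -[Ji _].
by rewrite linearZ/= adjointZ ?scalerA 1?mulrC//; exact: bndLambda.
Qed.

Hypothesis invM : invertible M.

Lemma op_inv_sqr_ge0 B : 0 < B -> 0 <= B * opnorm (op_inv M) ^+ 2.
Proof. by move=> B0; rewrite mulr_ge0 ?sqr_ge0// ltW. Qed.

(* Abstracts the two ways of absorbing the symbol m: the theorem uses
   (X, Y) = (Theta, m Lambda) and (X, Y) = (m Theta, Lambda). *)
Section Controlled.
Variables X Y : forall i, H -> Hi i.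
Hypothesis controlled : forall (t : R) f g i, 0 < t -> J i ->
  2 * rdot (m i *: adjoint (Lambda i) (Theta i f)) g <=
  t * rnorm (X i f) ^+ 2 + t^-1 * rnorm (Y i g) ^+ 2.

(** The termwise bound is summed over a finite ball, where the two sums are at most A and B; the
    remainder <M f - S n, g> is absorbed in an arbitrary e. *)
Lemma multiplier_young (t A B : R) f g : 0 < t ->
    (gsum J X f <= A%:E)%E -> (gsum J Y g <= B%:E)%E ->
  2 * rdot (M f) g <= t * A + t^-1 * B.
Proof.
move=> t0 XA YB; apply/ler_addgt0Pl => e e0.
pose S := multiplier_sum J m Lambda Theta f.
(* The 1 keeps the divisor positive when g = 0. *)
have c0 : 0 < 2 * (rnorm g + 1) by rewrite mulr_gt0// ltr_wpDl// rnorm_ge0.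
have SM : S @ \oo --> M f by exact: wdM.
have [n _ /(_ n (leqnn n))Sn] := rnorm_cvg _ _ SM _ (divr_gt0 e0 c0).
have -> : M f = S n + (-1)%:C *: (S n - M f).
  by rewrite rmorphN1 scaleN1r opprB addrC subrK.
rewrite rdotDl mulrDr addrC lerD//.
  apply: le_trans (_ : 2 * (rnorm (S n - M f) * rnorm g) <= _).
    rewrite ler_pM2l// (le_trans (rdot_le _ _))// rnormZ_real normrN1 mul1r//.
  rewrite mulrA -(mulrC (rnorm _)) mulrA mulrC.
  move: Sn; rewrite /= ler_pdivlMr//; have := rnorm_ge0 (S n - M f).
  have := rnorm_ge0 g; nra.
have ballJ : ball n `<=` J by move=> i [].
have := le_trans (sum_le_gsum _ X _ f (finite_ball n) ballJ) XA.
have := le_trans (sum_le_gsum _ Y _ g (finite_ball n) ballJ) YB.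
rewrite !lee_fin => hY hX.
apply: le_trans (lerD (ler_wpM2l (ltW t0) hX) (ler_wpM2l _ hY)); last first.
  by rewrite invr_ge0 ltW.
rewrite /S multiplier_sumE rdot_suml !mulr_sumr -big_split/=.
rewrite !big_seq; apply: ler_sum => i; rewrite in_fset_set// inE => -[Ji _].
exact: controlled.
Qed.

Lemma lower_gframe_bound_right (B : R) : gbessel_bound J X B ->
  lower_gframe_bound J Y ((B * opnorm (op_inv M) ^+ 2)%:E^-1)%E.
Proof.
move=> [B0 XB]; have K0 := op_inv_sqr_ge0 _ B0.
split=> [|g]; first exact: inve_fin_gt0.
apply: inve_mul_le; rewrite ?sqr_ge0 ?gsum_ge0// => s s0 Ys.
apply: le_of_young => // t t0.
(* With f = M^-1 g the left side is 2 |g|^2. *)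
have := multiplier_young t _ _ (op_inv M g) g t0 (XB _) Ys.
rewrite (op_invKV M invM) -rnorm_sqr => /le_trans; apply.
rewrite lerD2r ler_pM2l// -mulrA ler_pM2l//.
rewrite -exprMn lerXn2r ?nnegrE ?mulr_ge0 ?rnorm_ge0 ?opnorm_ge0//.
by have := rnorm_le_opnorm M multiplierZ invM (op_inv M g); rewrite op_invKV.
Qed.

Lemma lower_gframe_bound_left (B : R) : gbessel_bound J Y B ->
  lower_gframe_bound J X ((B * opnorm (op_inv M) ^+ 2)%:E^-1)%E.
Proof.
move=> [B0 YB]; have K0 := op_inv_sqr_ge0 _ B0.
split=> [|f]; first exact: inve_fin_gt0.
apply: inve_mul_le; rewrite ?sqr_ge0 ?gsum_ge0// => s s0 Xs.
have le_Mf : rnorm (M f) ^+ 2 <= B * s.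
  apply: le_of_young => // [|t t0]; first exact: ltW.
  have t0' : 0 < t^-1 by rewrite invr_gt0.
  (* The Bessel family is now the second one, so the parameter is inverted to put t in front of its
     sum. *)
  have := multiplier_young t^-1 _ _ f (M f) t0' Xs (YB _).
  by rewrite -rnorm_sqr invrK addrC.
rewrite mulrAC mulrC; apply: le_trans (ler_wpM2l (sqr_ge0 _) le_Mf).
rewrite -exprMn lerXn2r ?nnegrE ?mulr_ge0 ?rnorm_ge0 ?opnorm_ge0//.
exact: rnorm_le_opnorm multiplierZ invM f.
Qed.

Lemma gframes_of_gbessel : gbessel J X -> gbessel J Y -> gframe J X /\ gframe J Y.
Proof.
move=> X_bessel Y_bessel; case: (X_bessel) (Y_bessel) => [B XB] [B' YB].
split; split=> //; apply: lower_gframe_of_bound.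
  exact: lower_gframe_bound_left YB.
exact: lower_gframe_bound_right XB.
Qed.

End Controlled.

(** The scalar crosses the inner product as its conjugate, which has the same modulus. *)
Lemma controlled_right (t : R) f g i : 0 < t -> J i ->
  2 * rdot (m i *: adjoint (Lambda i) (Theta i f)) g <=
  t * rnorm (Theta i f) ^+ 2 + t^-1 * rnorm (gscale m Lambda i g) ^+ 2.
Proof.
move=> t0 Ji.
have -> : rdot (m i *: adjoint (Lambda i) (Theta i f)) g =
    rdot (Theta i f) (Num.conj (m i) *: Lambda i g).
  rewrite /rdot innerZl innerZr conjCK innerC -adjointP; last exact: bndLambda.
  by rewrite -innerC.
have -> : rnorm (gscale m Lambda i g) = rnorm (Num.conj (m i) *: Lambda i g).
  by rewrite /gscale !rnormZ norm_conjC.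
exact: rdot_young.
Qed.

Lemma controlled_left (t : R) f g i : 0 < t -> J i ->
  2 * rdot (m i *: adjoint (Lambda i) (Theta i f)) g <=
  t * rnorm (gscale m Theta i f) ^+ 2 + t^-1 * rnorm (Lambda i g) ^+ 2.
Proof.
move=> t0 Ji; apply: le_trans (rdot_young _ _ _ t0).
rewrite /rdot /gscale !innerZl innerC -adjointP; last exact: bndLambda.
by rewrite -innerC.
Qed.

End Multiplier.

(** * Bounded symbols *)

Section Scaling.
Context {R : realType} {J : set int} {H : hilbertType R} {Hi : int -> hilbertType R}.
Variables (m : int -> R[i]) (X : forall i, H -> Hi i).

Lemma ell_infty_pos : ell_infty J m ->
  exists2 D : R, 0 < D & forall i, J i -> `|m i| <= D%:C.
Proof.
(* C itself may be zero, or negative when J is empty; the enlarged bound can be divided by. *)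
move=> [C mC]; exists (`|C| + 1) => [|i /mC /le_trans]; first by rewrite ltr_wpDl.
by apply; rewrite lecR (le_trans (ler_norm C))// lerDl.
Qed.

Lemma lower_gframe_unscale : ell_infty J m ->
  lower_gframe J (gscale m X) -> lower_gframe J X.
Proof.
move=> /ell_infty_pos[D D0 mD] [A [A0 XA]].
have D2 : 0 < D ^+ 2 by rewrite exprn_gt0.
exists ((D ^+ 2)^-1 * A); split=> [|f].
  by rewrite lte_fin mulr_gt0 ?invr_gt0.
rewrite EFinM -muleA lee_pdivrMl//; apply: le_trans (XA f) _.
exact: gsum_gscale_le.
Qed.

Lemma gbessel_scale : ell_infty J m -> gbessel J X -> gbessel J (gscale m X).
Proof.
move=> /ell_infty_pos[D D0 mD] [B [B0 XB]].
exists (D ^+ 2 * B); split=> [|f]; first by rewrite mulr_gt0 ?exprn_gt0.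
apply: le_trans (gsum_gscale_le _ _ _ _ _ mD) _.
by rewrite -mulrA [leRHS]EFinM; apply: lee_wpmul2l; rewrite ?XB ?lee_fin ?sqr_ge0.
Qed.

End Scaling.

Theorem theorem3p2 (R : realType) (J : set int)
    (H : hilbertType R) (Hi : int -> hilbertType R)
    (sepH : separable H) (sepHi : forall i, J i -> separable (Hi i))
    (Lambda Theta : forall i : int, {linear H -> Hi i})
    (bndLambda : forall i, J i -> bounded_op (Lambda i))
    (bndTheta : forall i, J i -> bounded_op (Theta i))
    (m : int -> R[i])
    (wdM : multiplier_well_defined J m Lambda Theta)
    (invM : invertible (multiplier J m Lambda Theta)) :
  let M := multiplier J m Lambda Theta in
  [/\ (forall B : R, gbessel_bound J Theta B ->
         lower_gframe_bound J (gscale m Lambda)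
           ((B * opnorm (op_inv M) ^+ 2)%:E^-1)%E) /\
      (forall B : R, gbessel_bound J Lambda B ->
         lower_gframe_bound J (gscale m Theta)
           ((B * opnorm (op_inv M) ^+ 2)%:E^-1)%E),
      (gbessel J Theta -> gbessel J (gscale m Lambda) ->
         gframe J Theta /\ gframe J (gscale m Lambda)) /\
      (gbessel J Lambda -> gbessel J (gscale m Theta) ->
         gframe J Lambda /\ gframe J (gscale m Theta)),
      (gbessel J Theta -> ell_infty J m -> lower_gframe J Lambda) /\
      (gbessel J Lambda -> ell_infty J m -> lower_gframe J Theta)
    & gbessel J Theta -> gbessel J Lambda -> ell_infty J m ->
      [/\ gframe J Theta, gframe J Lambda,
          gframe J (gscale m Lambda) & gframe J (gscale m Theta)]].
Proof.
have XY := controlled_right Lambda Theta m bndLambda.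
have YX := controlled_left Lambda Theta m bndLambda.
pose right := lower_gframe_bound_right Lambda Theta m bndLambda wdM invM.
pose left := lower_gframe_bound_left Lambda Theta m bndLambda wdM invM.
pose both := gframes_of_gbessel Lambda Theta m bndLambda wdM invM.
move=> M; split.
- by split=> B; [exact: right XY B | exact: left YX B].
- split=> [ThB LaB|LaB ThB]; first exact: both XY ThB LaB.
  by have [] := both _ _ YX ThB LaB.
- split=> -[B hB] minf; apply: (lower_gframe_unscale _ _ minf).
    exact: lower_gframe_of_bound (right _ _ XY B hB).
  exact: lower_gframe_of_bound (left _ _ YX B hB).
- move=> ThB LaB minf.
  (* A bounded symbol preserves the Bessel property, so (ii) applies to both pairs. *)
  have [gTh gmLa] := both _ _ XY ThB (gbessel_scale _ _ minf LaB).
  by have [gmTh gLa] := both _ _ YX (gbessel_scale _ _ minf ThB) LaB.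
Qed.
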